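(* For every $n\ge 7$, $\mu(D(C_n))=n$, where $C_n$ is the cycle on $n$ vertices.
   Context: All graphs are finite and simple. The double graph $D(G)$ is obtained from the disjoint union of $G$ and a copy $G'$ with $V(G')=\{u': u\in V(G)\}$ by joining each $u\in V(G)$ to all neighbors of $u'$ in $G'$ and each $u'$ to all neighbors of $u$ in $G$. Given $S\subseteq V(H)$, two vertices $x,y$ are $S$-visible if some shortest $x,y$-path in $H$ has no internal vertex in $S$; $S$ is a mutual-visibility set if every two vertices of $S$ are $S$-visible; $\mu(H)$ is the maximum size of a mutual-visibility set of $H$. *)

(* Defs.v *)
From mathcomp Require Import all_boot.
From mathcomp Require Import boolp.

Set Implicit Arguments.
Unset Strict Implicit.
Unset Printing Implicit Defensive.

Record sgraph := SGraph {
  vertex :> finType;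
  adj : rel vertex;
  adj_sym : symmetric adj;
  adj_irrefl : irreflexive adj
}.

(* For n >= 3 this is the usual n-cycle; the conjunct [i != j] only matters
   for n = 1, where it rules out a loop. *)
Definition cycle_adj (n : nat) : rel 'I_n :=
  fun i j => (i != j) && ((j == i.+1 %% n :> nat) || (i == j.+1 %% n :> nat)).

Lemma cycle_adj_sym n : symmetric (@cycle_adj n).
Proof. by move=> i j; rewrite /cycle_adj eq_sym orbC. Qed.

Lemma cycle_adj_irrefl n : irreflexive (@cycle_adj n).
Proof. by move=> i; rewrite /cycle_adj eqxx. Qed.

Definition cycle_graph (n : nat) : sgraph :=
  SGraph (@cycle_adj_sym n) (@cycle_adj_irrefl n).

Section DoubleGraph.
Variable G : sgraph.

(* [inl u] is the vertex u of G and [inr u] is its copy u' in G'. *)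
Definition double_adj : rel (G + G)%type := fun x y =>
  match x, y with
  | inl u, inl v => adj u v
  | inr u, inr v => adj u v
  | inl u, inr v => adj u v
  | inr u, inl v => adj u v
  end.

Lemma double_adj_sym : symmetric double_adj.
Proof. by move=> [u|u] [v|v]; apply: adj_sym. Qed.

Lemma double_adj_irrefl : irreflexive double_adj.
Proof. by move=> [u|u]; apply: adj_irrefl. Qed.

Definition double_graph : sgraph := SGraph double_adj_sym double_adj_irrefl.

End DoubleGraph.

Section MutualVisibility.
Variable H : sgraph.

(* The vertex sequence of the path is [x :: p]. *)
Definition is_path (x y : H) (p : seq H) : Prop :=
  [/\ path (@adj H) x p, last x p = y & uniq (x :: p)].

Definition shortest_path (x y : H) (p : seq H) : Prop :=
  is_path x y p /\ forall q : seq H, is_path x y q -> size p <= size q.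

(* [x :: p] without its first and last vertices *)
Definition internal (x : H) (p : seq H) : seq H := behead (belast x p).

Definition visible (S : {set H}) (x y : H) : Prop :=
  exists2 p : seq H, shortest_path x y p
    & forall z : H, z \in internal x p -> z \notin S.

Definition mutual_visibility (S : {set H}) : Prop :=
  forall x y : H, x \in S -> y \in S -> x != y -> visible S x y.

Definition mu : nat := \max_(S : {set H} | `[< mutual_visibility S >]) #|S|.

End MutualVisibility.

(* Main.v *)
Require Import Defs.
From mathcomp Require Import all_boot.
From mathcomp Require Import boolp.
From mathcomp Require Import zify.

Set Implicit Arguments.
Unset Strict Implicit.
Unset Printing Implicit Defensive.

(** For the lower bound, a shortest path of [G] between two vertices lifts to a
shortest path of [D(G)] whose internal vertices all lie in the copy [G'], so
[V(G)] is a mutual-visibility set.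

For the upper bound, let [T] be the set of positions of the cycle both of whose
copies lie in [S], and [Z] the set of positions with no copy in [S]; then
[#|S| = n + #|T| - #|Z|]. Paths of length 2 and 3 of [C_n] are unique geodesics
for [n >= 7], hence for [t] in [T], if [t-1] is not in [Z] then [t+1] and [t+2]
both are. Mapping [t] to [t-1] if this is in [Z], and to [t+1] otherwise, is
therefore an injection of [T] into [Z]: a collision [t-1 = t'+1] would
put [t = t'+2] into [Z]. *)

Lemma exists_shortest_path (H : sgraph) (x y : H) :
  connect (@adj H) x y -> exists p, shortest_path x y p.
Proof.
move=> /connectP[p0 xp0 ->].
case: (shortenP xp0) => p xp up _; set z := last x p.
have exP : exists k, `[< exists2 q, is_path x z q & size q = k >].
  by exists (size p); apply/asboolP; exists p.
case: (ex_minnP exP) => k /asboolP[q xyq <-] min_q.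
by exists q; split=> // r xyr; apply: min_q; apply/asboolP; exists r.
Qed.

(** * Projection of a double graph onto its base graph, and lifting of geodesics *)

Section DoubleGraphTheory.
Variable G : sgraph.
Local Notation D := (double_graph G).

Definition base (x : D) : G := match x with inl u => u | inr u => u end.

Lemma double_adjE (x y : D) : adj x y = adj (base x) (base y).
Proof. by case: x y => [u|u] [v|v]. Qed.

Lemma path_base (x : D) (p : seq D) :
  path (@adj D) x p = path (@adj G) (base x) (map base p).
Proof. by elim: p x => //= y p IHp x; rewrite IHp -double_adjE. Qed.

(** Projecting by [base] turns any path of [D] into a walk of [G] with projected ends, so [D] has no
    shortcuts. *)
Lemma shortest_path_lift (u v : G) (q : seq G) :
  shortest_path u v (rcons q v) ->
  shortest_path (inl u : D) (inl v) (rcons (map inr q) (inl v)).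
Proof.
case=> -[uq _ uniq_q] min_q; split.
  split.
  - rewrite path_base map_rcons -map_comp /=.
    by rewrite (_ : map _ q = q) // -[RHS]map_id; apply: eq_map.
  - by rewrite last_rcons.
  - move: uniq_q; rewrite /= !mem_rcons !inE !rcons_uniq !negb_or.
    case/and3P=> /andP[uv _] _ uniq_q.
    rewrite map_inj_uniq; last exact: inr_inj.
    apply/and3P; split=> //.
    + by apply/andP; split; [apply: contraNneq uv => -[->]|apply/mapP => -[]].
    + by apply/mapP => -[].
move=> p [up last_p _].
move: up last_p; rewrite path_base => up last_p.
have: last u (map base p) = v by rewrite (last_map base p (inl u)) last_p.
case: (shortenP up) => p' up' uniq_p' sub_p' last_p'.
have := min_q p' (And3 up' last_p' uniq_p').
rewrite !size_rcons size_map => /leq_trans; apply.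
(* [shortenP] only gives inclusion in the projected walk; as [p'] has no repetition, this bounds its
   length. *)
rewrite -(size_map base p); apply: uniq_leq_size sub_p'.
by case/andP: uniq_p'.
Qed.

Lemma mutual_visibility_inl : (forall u v : G, connect (@adj G) u v) ->
  @mutual_visibility D (inl @: [set: G]).
Proof.
move=> conn _ _ /imsetP[u _ ->] /imsetP[v _ ->] uv.
have [p] := exists_shortest_path (conn u v).
case/lastP: p => [|q w] sp.
  by case: sp => -[_ /= uvE _] _; rewrite uvE eqxx in uv.
have wv : w = v by case: sp => -[_]; rewrite last_rcons.
rewrite {}wv in sp; exists (rcons (map inr q) (inl v)).
  exact: shortest_path_lift.
rewrite /internal belast_rcons /= => _ /mapP[z _ ->].
by apply/imsetP => -[].
Qed.

Lemma leq_card_mu_double : (forall u v : G, connect (@adj G) u v) ->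
  #|G| <= mu D.
Proof.
move=> /mutual_visibility_inl mv; rewrite -cardsT.
rewrite -(card_imset [set: G] (inl_inj : injective (@inl G G))).
by apply: (bigmax_sup (inl @: [set: G])) => //; apply/asboolP.
Qed.

(** Inclusion-exclusion for [A] and [B]; [A :&: B] is the set T, and [~: (A :|: B)] the set Z, of
    the overview. *)
Lemma card_double_set (S : {set D}) :
  let A := [set u : G | inl u \in S] in let B := [set u : G | inr u \in S] in
  #|S| + #|~: (A :|: B)| = #|G| + #|A :&: B|.
Proof.
move=> A B.
have -> : S = inl @: A :|: inr @: B :> {set D}.
  apply/setP => -[u|u]; rewrite !inE.
    rewrite mem_imset ?inE; last exact: inl_inj.
    by rewrite (_ : (_ \in inr @: B) = false) ?orbF //; apply/negP=> /imsetP[].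
  rewrite orbC mem_imset ?inE; last exact: inr_inj.
  by rewrite (_ : (_ \in inl @: A) = false) ?orbF //; apply/negP=> /imsetP[].
rewrite cardsU (_ : _ :&: _ = set0); last first.
  apply/setP=> x; rewrite !inE.
  by apply/negP => /andP[/imsetP[u _ ->] /imsetP[]].
rewrite cards0 subn0 !card_imset; [|exact: inr_inj|exact: inl_inj].
by rewrite -cardsUI -(cardsC (A :|: B)) addnAC.
Qed.

End DoubleGraphTheory.

(** * Rotation, walks and visibility on the cycle *)

Section Cycle.
Variable n : nat.
Local Notation C := (cycle_graph n).
Local Notation D := (double_graph C).

Lemma cycle_adjP (i j : C) : adj i j -> j = ordS i \/ i = ordS j.
Proof.
by case/andP=> _ /orP[/eqP ij|/eqP ij]; [left|right]; apply: val_inj.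
Qed.

Lemma val_iter_ordS k (i : 'I_n) : iter k (@ordS n) i = (i + k) %% n :> nat.
Proof.
elim: k => [|k IHk] /=; first by rewrite addn0 modn_small.
by rewrite IHk -addn1 modnDml addn1 addnS.
Qed.

Lemma iter_ordS_neq k (i : 'I_n) : 0 < k < n -> iter k (@ordS n) i != i.
Proof.
move=> /andP[k0 kn]; apply/eqP => /(congr1 val)/=; rewrite val_iter_ordS.
have := ltn_ord i; case: (ltnP (i + k) n) => ik lt_in.
  by rewrite modn_small //; lia.
rewrite -[in LHS](subnK ik) modnDr modn_small; lia.
Qed.

Lemma cycle_adj_ordS (i : C) : 1 < n -> adj i (ordS i : C).
Proof.
move=> n1; rewrite /adj /= /cycle_adj eqxx andbT.
by rewrite eq_sym (@iter_ordS_neq 1).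
Qed.

Lemma cycle_connect (i j : C) : 1 < n -> connect (@adj C) i j.
Proof.
move=> n1.
have step k (u : C) : connect (@adj C) u (iter k (@ordS n) u).
  elim: k => //= k IHk; apply: connect_trans IHk _.
  exact/connect1/cycle_adj_ordS.
(* From [i], [n - i] steps lead to 0 and [j] more to [j], whichever of the two is larger. *)
suff -> : j = iter (n - i + j) (@ordS n) i by apply: step.
apply: val_inj; rewrite /= val_iter_ordS addnA subnKC; last exact/ltnW/ltn_ord.
by rewrite modnDl modn_small.
Qed.

(** [a] counts the forward steps and [b] the backward ones; keeping them on separate sides avoids
    signed displacements. *)
Lemma cycle_path_displacement (i : C) (p : seq C) : path (@adj C) i p ->
  exists a b, a + b = size p
    /\ iter a (@ordS n) i = iter b (@ordS n) (last i p).
Proof.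
elim: p i => [|j p IHp] i /=; first by exists 0, 0.
case/andP=> /cycle_adjP ij /IHp[a [b [<- ab]]].
case: ij => [jE|->].
  by exists a.+1, b; rewrite iterSr -jE ab.
by exists a, b.+1; rewrite -iterSr iterS ab addnS.
Qed.

(* A first step backwards winds around the cycle in at most [2 * k] steps. *)
Lemma cycle_geodesic_head k (i j : C) (p : seq C) : k.*2 < n ->
  path (@adj C) i (j :: p) -> size (j :: p) <= k ->
  last j p = iter k (@ordS n) i -> j = ordS i.
Proof.
move=> kn /= /andP[/cycle_adjP[//|ij] /cycle_path_displacement[a [b [pE ab]]]].
move=> pk lastE; move: ab; rewrite lastE ij -iterSr -iterD => ab.
have {}pk : a + b < k by rewrite pE.
have a_lt : a < b + k.+1 by lia.
(* Cancelling [iter a] leaves a return to [j] after [b + k.+1 - a] steps, a number between 1 and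
   [k.*2]. *)
have := ab; rewrite -(subnKC (ltnW a_lt)) iterD.
have iter_inj : injective (iter a (@ordS n)).
  by elim: (a) => //= m IHm u v /(can_inj (@ordSK n))/IHm.
move/iter_inj/esym/eqP => loop.
suff /iter_ordS_neq/negP : 0 < b + k.+1 - a < n by case/(_ j).
lia.
Qed.

(** Every shortest path from [x] to [y] must start forwards, hence meet one of the two copies of the
    next position, both in [S]. The distance is at least 2, so that this vertex is internal. *)
Lemma not_visible_past_full k (S : {set D}) (x y : D) : k.+2.*2 < n ->
  inl (ordS (base x)) \in S -> inr (ordS (base x)) \in S ->
  base y = iter k.+2 (@ordS n) (base x) -> ~ visible S x y.
Proof.
move=> kn tl tr yE [p [[xp last_p _] min_p] hid].
have p_short : size p <= k.+2.
  (* The forward arc, lifted to [D], bounds the distance from [x] to [y]. *)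
  pose w := rcons (map inl (traject (@ordS n) (ordS (base x)) k.+1)) y : seq D.
  have xw : path (@adj D) x w.
    rewrite path_base map_rcons -map_comp yE iterSr.
    rewrite (_ : map _ _ = traject (@ordS n) (ordS (base x)) k.+1); last first.
      by rewrite -[RHS]map_id; apply: eq_map.
    rewrite -trajectSr; apply: (@sub_path _ (frel (@ordS n))).
      by move=> i _ /eqP <-; apply: cycle_adj_ordS; lia.
    exact: fpath_traject.
  have: last x w = y by rewrite last_rcons.
  case: (shortenP xw) => q xq uq sub_q last_q.
  apply: leq_trans (min_p q (And3 xq last_q uq)) _.
  rewrite (_ : k.+2 = size w); last by rewrite size_rcons size_map size_traject.
  by apply: uniq_leq_size sub_q; case/andP: uq.
case: p xp last_p p_short hid {min_p} => [|z p] xp last_p p_short hid.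
  have /eqP[] := @iter_ordS_neq k.+2 (base x) ltac:(lia).
  by rewrite -yE -last_p.
have zE : base z = ordS (base x).
  apply: (@cycle_geodesic_head k.+2 (base x) (base z) (map (@base C) p)).
  - exact: kn.
  - by move: xp; rewrite path_base.
  - by rewrite /= size_map.
  - by rewrite last_map -[RHS]yE -last_p.
case: p xp last_p p_short hid => [|z' p] /= xp last_p p_short hid.
  have /eqP[] := @iter_ordS_neq k.+1 (ordS (base x)) ltac:(lia).
  by rewrite -iterSr -yE -last_p.
have /negP[] := hid z (mem_head _ _).
by case: z zE {hid xp p_short} => u /= ->.
Qed.

Lemma mutual_visibility_card (S : {set D}) : 7 <= n ->
  mutual_visibility S -> #|S| <= n.
Proof.
move=> n7 mvS.
set A := [set u : C | inl u \in S]; set B := [set u : C | inr u \in S].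
have occupied u : u \notin ~: (A :|: B) -> exists2 x : D, x \in S & base x = u.
  by rewrite !inE negbK => /orP[uS|uS]; [exists (inl u)|exists (inr u)].
(* An occupied position before [t] cannot see past [t]: the cases [k = 0] and [k = 1] exclude
   distances 2 and 3. The latter requires [6 < n]. *)
have gap t : t \in A :&: B -> ord_pred t \notin ~: (A :|: B) ->
    (ordS t \in ~: (A :|: B)) && (ordS (ordS t) \in ~: (A :|: B)).
  case/setIP; rewrite [_ \in A]inE [_ \in B]inE => tl tr /occupied[x xS xt].
  have tx : t = ordS (base x) by rewrite xt ord_predK.
  rewrite tx in tl tr *.
  apply/andP; split; apply/negPn/negP => /occupied[y yS yt].
    apply: (@not_visible_past_full 0 S x y _ tl tr yt); [lia|apply: mvS => //].
    have /eqP loop := @iter_ordS_neq 2 (base x) ltac:(lia).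
    by apply/eqP => xy; apply: loop; rewrite /= -yt xy.
  apply: (@not_visible_past_full 1 S x y _ tl tr yt); [lia|apply: mvS => //].
  have /eqP loop := @iter_ordS_neq 3 (base x) ltac:(lia).
  by apply/eqP => xy; apply: loop; rewrite /= -yt xy.
pose f t := if ord_pred t \in ~: (A :|: B) then ord_pred t else ordS t.
have disj t : t \in A :&: B -> t \notin ~: (A :|: B).
  by rewrite !inE => /andP[-> ->].
have f_inj : {in A :&: B &, injective f}.
  have noclash s t : s \in A :&: B -> t \in A :&: B ->
      ord_pred t \notin ~: (A :|: B) -> ord_pred s <> ordS t.
    move=> sT tT /(gap _ tT)/andP[_ tZ] st.
    by move/negP: (disj _ sT); apply; rewrite -(ord_predK s) st.
  move=> s t sT tT; rewrite /f.
  case: ifPn => sZ; case: ifPn => tZ.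
  - exact: (can_inj (@ord_predK n)).
  - by move/noclash; case.
  - by move/esym/noclash; case.
  - exact: (can_inj (@ordSK n)).
have : #|A :&: B| <= #|~: (A :|: B)|.
  rewrite -(card_in_imset f_inj).
  apply/subset_leq_card/subsetP => _ /imsetP[t tT ->].
  by rewrite /f; case: ifPn => // /(gap _ tT)/andP[].
have := card_double_set S; rewrite -/A -/B card_ord /=; lia.
Qed.

End Cycle.

Theorem theorem3p3 (n : nat) (hn : 7 <= n) :
  mu (double_graph (cycle_graph n)) = n.
Proof.
apply/eqP; rewrite eqn_leq; apply/andP; split.
  by apply/bigmax_leqP => S /asboolP; apply: mutual_visibility_card.
rewrite -[X in X <= _]card_ord; apply: leq_card_mu_double => u v.
by apply: cycle_connect; lia.
Qed.
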